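(* Suppose that a positively presented monoid $G^+=\langle L\mid R\rangle_{mo}$ is a Garside monoid. Let $\widehat\Delta$ be the unique minimal fundamental element in $G^+$, and let $\Delta$ be an indecomposable quasi-central element in $G^+$. Then $\Delta$ divides $\widehat\Delta$ from the left and from the right.
   Context: $L$ is a finite set, $R$ a finite set of relations $R_i=S_i$ between positive words (words in the free monoid $L^*$), and $G^+=\langle L\mid R\rangle_{mo}$ is the quotient of $L^*$ by the congruence generated by $R$. $G^+$ is atomic if there is a map $\nu:G^+\to\mathbb{Z}_{\ge 0}$ with $\nu(\alpha)=0\iff\alpha=1$ and $\nu(\alpha\beta)\ge\nu(\alpha)+\nu(\beta)$ for all $\alpha,\beta$. It is cancellative if $AXB=AYB$ implies $X=Y$. An atom is an element $\alpha\ne 1$ such that $\alpha=\beta\gamma$ implies $\beta=1$ or $\gamma=1$. A generator $g\in L$ is a dummy generator if $R$ contains a relation $g=w$ with $w$ a positive word in the generators other than $g$; $\widetilde L$ is the set of non-dummy generators. Its image in $G^+$ is the set of all atoms, and $\widetilde L$ is identified with this image. An element $\Delta\in G^+$ is quasi-central if there is a permutation $\sigma$ of $\widetilde L$ with $s\cdot\Delta=\Delta\cdot\sigma(s)$ for all $s\in\widetilde L$. It is indecomposable if $\Delta\neq1$ and it is not a product of two quasi-central elements both different from $1$. A fundamental element is an element $\Delta\in G^+$ for which there is a permutation $\sigma$ of $\widetilde L$ such that for every $s\in\widetilde L$ there is $\Delta_s\in G^+$ with $\Delta=s\cdot\Delta_s=\Delta_s\cdot\sigma(s)$ (the identity is not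 a fundamental element). A fundamental element $\Delta$ is minimal if any fundamental element dividing $\Delta$ from the right or the left coincides with $\Delta$. In a Garside monoid there is exactly one minimal fundamental element $\widehat\Delta$. $U$ divides $V$ from the left (right) if $V=UW$ (resp. $V=WU$) for some $W\in G^+$. The LCM condition: any two elements $U,V$ have a right least common multiple (an element left-divisible by $U$ and $V$ which divides from the left every element left-divisible by both) and a left least common multiple (defined symmetrically). A positively presented monoid $G^+$ is a Garside monoid if it is atomic, cancellative, satisfies the LCM condition, and has a fundamental element. *)

(* Defs.v *)
From HB Require Import structures.
From mathcomp Require Import all_boot.
From mathcomp Require Import boolp classical_sets functions.

Set Implicit Arguments.
Unset Strict Implicit.
Unset Printing Implicit Defensive.

Local Open Scope group_scope.
Local Open Scope quotient_scope.

Section PresentedMonoid.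
Variables (L : finType) (R : seq (seq L * seq L)).

Inductive word_cong : seq L -> seq L -> Prop :=
| WordCongRel u v : (u, v) \in R -> word_cong u v
| WordCongRefl u : word_cong u u
| WordCongSym u v : word_cong u v -> word_cong v u
| WordCongTrans u v w : word_cong u v -> word_cong v w -> word_cong u w
| WordCongCat u u' v v' :
    word_cong u u' -> word_cong v v' -> word_cong (u ++ v) (u' ++ v').

Definition word_congb : rel (seq L) := fun u v => `[< word_cong u v >].

Lemma word_congb_refl : reflexive word_congb.
Proof. by move=> u; apply/asboolP; exact: WordCongRefl. Qed.

Lemma word_congb_sym : symmetric word_congb.
Proof. by move=> u v; apply/asboolP/asboolP; exact: WordCongSym. Qed.

Lemma word_congb_trans : transitive word_congb.
Proof.
move=> v u w /asboolP uv /asboolP vw.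
by apply/asboolP; exact: WordCongTrans uv vw.
Qed.

Canonical word_cong_equiv :=
  EquivRel word_congb word_congb_refl word_congb_sym word_congb_trans.

Definition presented_monoid := {eq_quot word_cong_equiv}.

HB.instance Definition _ := Choice.on presented_monoid.

Definition class_of_word (u : seq L) : presented_monoid := \pi_presented_monoid u.

Lemma class_of_wordP u v : class_of_word u = class_of_word v <-> word_cong u v.
Proof.
split; first by move/eqmodP => /asboolP.
by move=> uv; apply/eqmodP/asboolP.
Qed.

Lemma class_of_word_surj x : exists u, x = class_of_word u.
Proof. by exists (repr x); rewrite /class_of_word reprK. Qed.

Definition presented_mul (x y : presented_monoid) : presented_monoid :=
  class_of_word (repr x ++ repr y).

Definition presented_one : presented_monoid := class_of_word [::].

Lemma presented_mulE u v :
  presented_mul (class_of_word u) (class_of_word v) = class_of_word (u ++ v).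
Proof.
by apply/class_of_wordP/WordCongCat;
  apply/class_of_wordP; rewrite /class_of_word reprK.
Qed.

Lemma presented_mulA : associative presented_mul.
Proof.
move=> x y z.
have [u ->] := class_of_word_surj x.
have [v ->] := class_of_word_surj y.
have [w ->] := class_of_word_surj z.
by rewrite !presented_mulE catA.
Qed.

Lemma presented_mul1 : left_id presented_one presented_mul.
Proof. by move=> x; have [u ->] := class_of_word_surj x; rewrite presented_mulE. Qed.

Lemma presented_1mul : right_id presented_one presented_mul.
Proof.
by move=> x; have [u ->] := class_of_word_surj x; rewrite presented_mulE cats0.
Qed.

HB.instance Definition _ := isMonoid.Build presented_monoid
  presented_mulA presented_mul1 presented_1mul.

Lemma class_of_word1 : class_of_word [::] = 1.
Proof. by []. Qed.

Lemma class_of_wordM u v :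
  class_of_word (u ++ v) = class_of_word u * class_of_word v.
Proof. by rewrite -presented_mulE. Qed.

End PresentedMonoid.

Section Garside.
Variable G : monoidType.
Implicit Types (U V W M N D A B X Y : G).

Definition atomic := exists nu : G -> nat,
  (forall A, nu A = 0 <-> A = 1) /\
  (forall A B, nu A + nu B <= nu (A * B)%g)%N.

Definition cancellative :=
  forall A B X Y, A * X * B = A * Y * B -> X = Y.

Definition ldivides U V := exists W, V = U * W.

Definition rdivides U V := exists W, V = W * U.

Definition is_right_lcm U V M :=
  [/\ ldivides U M, ldivides V M &
      forall N, ldivides U N -> ldivides V N -> ldivides M N].

Definition is_left_lcm U V M :=
  [/\ rdivides U M, rdivides V M &
      forall N, rdivides U N -> rdivides V N -> rdivides M N].

Definition lcm_condition := forall U V,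
  (exists M, is_right_lcm U V M) /\ (exists M, is_left_lcm U V M).

(* The non-dummy generators, identified with their image in G.  This image is
   taken to be the set of atoms itself, because a syntactic definition of the
   dummy generators only yields the atoms for reduced presentations: if the
   relations contain both b = c and c = b then both b and c are dummy. *)
Definition atoms : set G := [set A |
  A <> 1 /\ forall X Y, A = X * Y -> X = 1 \/ Y = 1]%classic.

Definition quasi_central D := exists sigma : G -> G,
  set_bij atoms atoms sigma /\ forall A, atoms A -> A * D = D * sigma A.

Definition indecomposable D := D <> 1 /\
  ~ exists X Y,
      [/\ quasi_central X, quasi_central Y, X <> 1, Y <> 1 & D = X * Y].

(* [D <> 1] only matters when there are no atoms. *)
Definition fundamental D := D <> 1 /\
  exists sigma : G -> G, set_bij atoms atoms sigma /\
    forall A, atoms A -> exists X, D = A * X /\ D = X * sigma A.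

Definition minimal_fundamental D := fundamental D /\
  forall X, fundamental X -> ldivides X D \/ rdivides X D -> X = D.

Definition garside :=
  [/\ atomic, cancellative, lcm_condition & exists D, fundamental D].

End Garside.

(* Main.v *)
Require Import Defs.
From mathcomp Require Import all_boot.
From mathcomp Require Import boolp classical_sets.

(** Let [H] be a fundamental element and [D] an indecomposable quasi-central one,
    and let [E] be their left gcd. The heart of the matter is that [E] is again
    quasi-central. Since every element can be moved from the left to the right
    of [D] and of [H] by conjugation, an lcm argument gives
    [A * E = E * phi A] for every [A] ([left_gcd_normal]), where [phi] is an
    injective endomorphism by cancellation; what has to be excluded is that
    [phi] misses some atoms. Some positive power [C] of [H] is central
    ([quasi_central_power_central]), so [phi] fixes [C] and permutes the left
    divisors of [C], which are finite in number by atomicity. All atoms divide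
    [C], so [phi] is onto, hence an automorphism, and therefore permutes the
    atoms ([normal_quasi_central]).

    Now write [D = E * X]. The cofactor [X] is quasi-central for the same
    reason. An atom dividing [D] also divides [H], so [E] is not trivial;
    indecomposability forces [X = 1], that is, [D = E] divides [H] from the left.
    Finally, every right multiple of a quasi-central element is also a left
    multiple of it, which gives divisibility from the right. *)

Set Implicit Arguments.
Unset Strict Implicit.
Unset Printing Implicit Defensive.

Local Open Scope group_scope.

(** * Periodic points of injections of finite sets *)

Lemma finite_orbit_periodic (T : eqType) (P : T -> Prop) (s : seq T)
    (f : T -> T) (x : T) :
    (forall y, P y -> y \in s) -> (forall y, P y -> P (f y)) ->
    (forall y z, P y -> P z -> f y = f z -> y = z) -> P x ->
  exists k, iter k.+1 f x = x.
Proof.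
move=> Ps Pf f_inj Px.
have Pit n : P (iter n f x) by elim: n => //= n; exact: Pf.
have : looping f x (size s).
  apply: contraT; rewrite -looping_uniq => uniq_orbit.
  have : {subset traject f x (size s).+1 <= s}.
    by move=> y /trajectP[i _ ->]; exact/Ps/Pit.
  by move/(uniq_leq_size uniq_orbit); rewrite size_traject ltnn.
case/trajectP => i lt_i eq_it.
exists (size s - i).-1; rewrite prednK ?subn_gt0 //.
have {eq_it} : iter (i + (size s - i)) f x = iter i f x by rewrite subnKC // ltnW.
elim: i {lt_i} (size s - i)%N => [|i IHi] n //.
by rewrite addSn !iterS => /f_inj eq_it; apply: IHi; apply: eq_it.
Qed.

Lemma common_period (T : eqType) (P : T -> Prop) (s : seq T) (f : T -> T) :
    (forall y, P y -> y \in s) -> (forall y, P y -> P (f y)) ->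
    (forall y z, P y -> P z -> f y = f z -> y = z) ->
  exists k, forall x, P x -> iter k.+1 f x = x.
Proof.
move=> Ps Pf f_inj.
suff [k k_per] : exists k, forall x, x \in s -> P x -> iter k.+1 f x = x.
  by exists k => x Px; apply: k_per => //; exact: Ps.
elim: {1}s => [|y r [k IHk]]; first by exists 0.
have iter_fix m n x : iter m f x = x -> iter (m * n) f x = x.
  by move=> fx; rewrite mulnC; elim: n => // n IHn; rewrite mulSn iterD IHn.
have [Py|nPy] := pselect (P y); last first.
  by exists k => x /[!inE]/predU1P[->|/IHk].
have [l l_per] := finite_orbit_periodic Ps Pf f_inj Py.
(* A common multiple of the two periods, positive by its shape. *)
exists (k.+1 * l.+1).-1 => x /[!inE] /predU1P[-> _|xr Px]; rewrite prednK //.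
  by rewrite mulnC; exact: iter_fix.
exact/iter_fix/IHk.
Qed.

(** * Quasi-central elements of atomic cancellative monoids *)

(** One-sided weakening of quasi-centrality: conjugation by [X] is only required
    to be defined on the whole monoid, not to permute the atoms. *)
Definition normal_element (G : monoidType) (X : G) :=
  forall U, exists V, U * X = X * V.

Section GarsideMonoid.
Variable G : monoidType.
Implicit Types (A B D E F U V W X Y : G).

Lemma cancell A X Y : cancellative G -> A * X = A * Y -> X = Y.
Proof. by move=> canG eqXY; apply: (canG A 1); rewrite !mulg1. Qed.

Lemma cancelr B X Y : cancellative G -> X * B = Y * B -> X = Y.
Proof. by move=> canG eqXY; apply: (canG 1 B); rewrite !mul1g. Qed.

Lemma atomic_mul1 U V : atomic G -> U * V = 1 -> U = 1 /\ V = 1.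
Proof.
case=> nu [nu0 nuM] UV1; have := nuM U V.
rewrite UV1 (nu0 1).2 // leqn0 addn_eq0 => /andP[/eqP nuU /eqP nuV].
by split; apply/nu0.
Qed.

(** A factorization into two nontrivial factors lowers [nu] on both of them, so
    factoring an element repeatedly ends with atoms. *)
Lemma atoms_generate : atomic G -> forall P : G -> Prop, P 1 ->
    (forall A, atoms A -> P A) -> (forall U V, P U -> P V -> P (U * V)) ->
  forall U, P U.
Proof.
case=> nu [nu0 nuM] P P1 Patom PM U.
have [n] := ubnP (nu U); elim: n U => // n IHn U; rewrite ltnS => le_nuU.
have [->//|U1] := pselect (U = 1).
have [/Patom//|] := pselect (atoms U).
move=> /not_andP[//|] /existsNP[X] /existsNP[Y] /not_implyP[defU].
case/not_orP => X1 Y1; rewrite defU.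
have pos Z : Z <> 1 -> (0 < nu Z)%N.
  by move=> Z1; rewrite lt0n; apply/eqP => /nu0.
have le_n : (nu X + nu Y <= n)%N by rewrite (leq_trans _ le_nuU) // defU nuM.
apply: PM; apply: IHn; apply: leq_trans le_n.
  by rewrite -addn1 leq_add2l pos.
by rewrite -add1n leq_add2r pos.
Qed.

Lemma atom_ldivides U : atomic G -> U <> 1 ->
  exists2 A, atoms A & ldivides A U.
Proof.
move=> atG; elim/(atoms_generate atG): U => [//|A atA _|U V IHU IHV UV1].
  by exists A => //; exists 1; rewrite mulg1.
have [U1|/IHU[A atA [W ->]]] := pselect (U = 1); last first.
  by exists A => //; exists (W * V); rewrite mulgA.
by move: UV1; rewrite U1 mul1g => /IHV.
Qed.

(** The values of [nu] on the divisors of [C] are at most [nu C], and an element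
    with [nu] at most [n] is a product of at most [n] atoms. *)
Lemma finite_ldivisors (s : seq G) C : atomic G ->
    (forall A, atoms A -> A \in s) ->
  exists t : seq G, forall U, ldivides U C -> U \in t.
Proof.
move=> atG sP; have [nu [nu0 nuM]] := atG.
have [t tP] : exists t : seq G, forall U, (nu U <= nu C)%N -> U \in t.
  elim: (nu C) => [|n [t IHt]].
    by exists [:: 1] => U; rewrite leqn0 inE => /eqP/nu0 ->.
  exists (1 :: [seq A * U | A <- s, U <- t]) => U le_U; rewrite inE.
  have [->|/(atom_ldivides atG)[A atA [V defU]]] := pselect (U = 1).
    by rewrite eqxx.
  rewrite defU allpairs_f ?orbT ?sP //; apply: IHt; rewrite -ltnS.
  apply: leq_trans le_U; rewrite defU (leq_trans _ (nuM A V)) //.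
  rewrite -add1n leq_add2r lt0n; apply/eqP => /nu0 A1.
  by case: atA.
exists t => U [V defC]; apply: tP.
by rewrite defC (leq_trans _ (nuM U V)) ?leq_addr.
Qed.

Lemma normal_from_atoms X : atomic G ->
  (forall A, atoms A -> exists V, A * X = X * V) -> normal_element X.
Proof.
move=> atG normX U; elim/(atoms_generate atG): U => [|//|U V [U' eU] [V' eV]].
  by exists 1; rewrite mulg1 mul1g.
by exists (U' * V'); rewrite -mulgA eV !mulgA eU.
Qed.

Lemma quasi_central_normal X : atomic G -> quasi_central X ->
  normal_element X.
Proof.
move=> atG [sigma [_ sX]]; apply: normal_from_atoms => // A /sX ->.
by exists (sigma A).
Qed.

(** The surjectivity of the permutation of the atoms allows moving elements from
    the right of [X] to its left, besides the converse direction. *)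
Lemma quasi_central_conormal X V : atomic G -> quasi_central X ->
  exists U, X * V = U * X.
Proof.
move=> atG [sigma [[_ _ surj] sX]].
elim/(atoms_generate atG): V => [|B atB|U V [U' eU] [V' eV]].
- by exists 1; rewrite mulg1 mul1g.
- by have [A atA <-] := surj _ atB; exists A; rewrite sX.
by exists (U' * V'); rewrite mulgA eU -!mulgA eV.
Qed.

Lemma fundamental_quasi_central X : fundamental X -> quasi_central X.
Proof.
case=> _ [sigma [bij sX]]; exists sigma; split=> // A /sX[Y [e1 e2]].
by rewrite {1}e2 mulgA -e1.
Qed.

(** Conjugation by [X] permutes the finitely many atoms, so a power of it is
    the identity on them. *)
Lemma quasi_central_power_central (s : seq G) X : atomic G ->
    (forall A, atoms A -> A \in s) -> quasi_central X ->
  exists k, forall U, U * X ^+ k.+1 = X ^+ k.+1 * U.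
Proof.
move=> atG sP [sigma [[fun_s inj_s _] sX]].
have [|k kP] := common_period sP fun_s.
  by move=> y z Py Pz; apply: inj_s; rewrite inE.
exists k; elim/(atoms_generate atG) => [|A atA|U V IHU IHV].
- by rewrite mulg1 mul1g.
- rewrite -[in RHS](kP A atA).
  have at_it n : atoms (iter n sigma A) by elim: n => //= n; exact: fun_s.
  elim: k.+1 => [|n IHn]; first by rewrite mulg1 mul1g.
  by rewrite expgSr iterS mulgA IHn -!mulgA sX.
by rewrite -mulgA IHV !mulgA IHU.
Qed.

(** Conjugation by [X] is an injective endomorphism [phi] fixing the central
    element [C]. It therefore maps the finite set of left divisors of [C] into
    itself, and injectivity makes each of them periodic. This puts all the atoms
    in the image of [phi], so [phi] is an automorphism. *)
Lemma normal_quasi_central (s : seq G) C X : atomic G -> cancellative G ->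
    (forall A, atoms A -> A \in s) ->
    (forall U, U * C = C * U) -> (forall A, atoms A -> ldivides A C) ->
  normal_element X -> quasi_central X.
Proof.
move=> atG canG sP cenC atC /choice[phi phiP].
have phi_inj U V : phi U = phi V -> U = V.
  by move=> eq_phi; apply: (cancelr (B := X)) => //; rewrite !phiP eq_phi.
have phiM U V : phi (U * V) = phi U * phi V.
  by apply: (cancell (A := X)) => //; rewrite -phiP -mulgA phiP !mulgA phiP.
have phi1 : phi 1 = 1.
  by apply: (cancell (A := X)) => //; rewrite -phiP mulg1 mul1g.
have phiC : phi C = C.
  by apply: (cancell (A := X)) => //; rewrite -phiP cenC.
have [t tP] := finite_ldivisors C atG sP.
have phi_div U : ldivides U C -> ldivides (phi U) C.
  by case=> V defC; exists (phi V); rewrite -phiM -defC phiC.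
have phi_surj U : exists V, phi V = U.
  elim/(atoms_generate atG): U => [|A atA|U V [U' <-] [V' <-]].
  - by exists 1.
  (* An atom [A] of period [k.+1] is the image of [iter k phi A]. *)
  - have [|k kP] := finite_orbit_periodic tP phi_div _ (atC A atA).
      by move=> y z _ _; exact: phi_inj.
    by exists (iter k phi A); rewrite -iterS.
  by exists (U' * V').
have phi_eq1 U : phi U = 1 -> U = 1 by rewrite -[in X in X -> _]phi1 => /phi_inj.
exists phi; split=> //; split.
- move=> A [A1 atA]; split=> [/phi_eq1//|U V].
  have [U' <-] := phi_surj U; have [V' <-] := phi_surj V.
  by rewrite -phiM => /phi_inj/atA[] ->; rewrite phi1; [left | right].
- by move=> U V _ _; exact: phi_inj.
move=> B [B1 atB]; have [A defB] := phi_surj B.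
exists A => //; split=> [A1|U V defA]; first by apply: B1; rewrite -defB A1.
have /atB[] : B = phi U * phi V by rewrite -phiM -defA.
  by move/phi_eq1; left.
by move/phi_eq1; right.
Qed.

(** * Left greatest common divisors *)

(** Among the common left divisors choose one, [E], with the largest value of
    [nu]. Its right lcm with another common divisor is again a common divisor,
    so by maximality it cannot be a proper multiple of [E]. *)
Lemma left_gcd_exists U V : atomic G -> lcm_condition G ->
  exists E, [/\ ldivides E U, ldivides E V &
    forall F, ldivides F U -> ldivides F V -> ldivides F E].
Proof.
case=> nu [nu0 nuM] lcmG.
pose hit n := `[< exists E, [/\ ldivides E U, ldivides E V & nu E = n] >].
have ex_hit : exists n, hit n.
  by exists (nu 1); apply/asboolP; exists 1; split=> //;
    [exists U | exists V]; rewrite mul1g.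
have hit_le n : hit n -> (n <= nu U)%N.
  move=> /asboolP[E [[W ->] _ <-]].
  by rewrite (leq_trans _ (nuM E W)) ?leq_addr.
case: (ex_maxnP ex_hit hit_le) => n /asboolP[E [EU EV nuE]] max_n.
exists E; split=> // F FU FV.
have [M [[W defM] FM minM]] := (lcmG E F).1.
have /max_n : hit (nu M) by apply/asboolP; exists M; split=> //; exact: minM.
have le_EW := nuM E W; rewrite -defM nuE in le_EW.
move=> /(leq_trans le_EW); rewrite -{2}[n]addn0 leq_add2l leqn0 => /eqP/nu0 W1.
by move: FM; rewrite defM W1 mulg1.
Qed.

(** Let [A * F] be the right lcm of [A] and [E]. Since [E] divides both [A * U]
    and [A * V] (as [U] and [V] are normal), so does [A * F]; thus [F] divides
    [U] and [V], hence divides [E], and [E] divides [A * F], which divides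
    [A * E]. *)
Lemma left_gcd_normal U V E : atomic G -> cancellative G -> lcm_condition G ->
    normal_element U -> normal_element V ->
    ldivides E U -> ldivides E V ->
    (forall F, ldivides F U -> ldivides F V -> ldivides F E) ->
  normal_element E.
Proof.
move=> atG canG lcmG normU normV EU EV maxE A.
have [M [[F defM] EM minM]] := (lcmG A E).1.
have FZ Z : normal_element Z -> ldivides E Z -> ldivides F Z.
  move=> /(_ A)[Z' eqZ] [W defZ].
  have [||W' defAZ] := minM (A * Z); first by exists Z.
    by exists (W * Z'); rewrite eqZ {1}defZ mulgA.
  by exists W'; apply: (cancell (A := A)) => //; rewrite defAZ defM mulgA.
have [W' defE] := maxE F (FZ U normU EU) (FZ V normV EV).
by case: EM => W defM'; exists (W * W'); rewrite [in LHS]defE !mulgA -defM' defM.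
Qed.

(** * Indecomposable quasi-central divisors of fundamental elements *)

Lemma indecomposable_ldivides_fundamental (s : seq G) D H : atomic G ->
    cancellative G -> lcm_condition G -> (forall A, atoms A -> A \in s) ->
    fundamental H -> quasi_central D -> indecomposable D ->
  ldivides D H.
Proof.
move=> atG canG lcmG sP fundH qcD [D1 indecD].
have qcH := fundamental_quasi_central fundH.
have at_H A : atoms A -> ldivides A H.
  by case: fundH => _ [sigma [_ sH]] /sH[X [defH _]]; exists X.
have [k cenC] := quasi_central_power_central atG sP qcH.
have at_C A : atoms A -> ldivides A (H ^+ k.+1).
  by case/at_H => X defH; exists (X * H ^+ k); rewrite expgS {1}defH mulgA.
have normal_qc := normal_quasi_central atG canG sP cenC at_C.
have [normD normH] := (quasi_central_normal atG qcD, quasi_central_normal atG qcH).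
have [E [ED EH maxE]] := left_gcd_exists D H atG lcmG.
have qcE : quasi_central E by apply/normal_qc/(left_gcd_normal (U := D) (V := H)).
have E1 : E <> 1.
  move=> E1; have [A atA AD] := atom_ldivides atG D1.
  have [W] := maxE A AD (at_H A atA); rewrite E1 => /esym/(atomic_mul1 atG)[A1 _].
  by case: atA.
have [X defD] := ED.
(* To move [U] to the right of [X], move it to the left of [E] first, and then
   to the right of [D = E * X]. *)
have qcX : quasi_central X.
  apply/normal_qc => U; have [V eqV] := quasi_central_conormal U atG qcE.
  have [W eqW] := normD V; exists W; apply: (cancell (A := E)) => //.
  by rewrite !mulgA eqV -(mulgA V) -defD.
have X1 : X = 1 by apply: contrapT => X1; apply: indecD; exists E, X.
by rewrite defD X1 mulg1.
Qed.

Lemma quasi_central_ldivides_rdivides D V : atomic G -> quasi_central D ->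
  ldivides D V -> rdivides D V.
Proof.
move=> atG qcD [W ->].
by have [U ->] := quasi_central_conormal W atG qcD; exists U.
Qed.

End GarsideMonoid.

(** * Presented monoids *)

(** In an atom all letters of a representing word but one are trivial; the
    finiteness of the alphabet thus makes the atoms finite in number. *)
Lemma presented_atoms_letters (L : finType) (R : seq (seq L * seq L))
    (A : presented_monoid R) : atoms A ->
  A \in [seq class_of_word R [:: l] | l <- enum L].
Proof.
have [u ->] := class_of_word_surj A.
elim: u => [[/(_ (class_of_word1 R))]//|l u IHu atA].
have [_ /(_ _ _ (class_of_wordM R [:: l] u))[l1|u1]] := atA.
  by move: atA; rewrite -cat1s class_of_wordM l1 mul1g => /IHu.
by rewrite -cat1s class_of_wordM u1 mulg1; apply/mapP; exists l; rewrite ?mem_enum.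
Qed.

Theorem proposition2p8 (L : finType) (R : seq (seq L * seq L))
    (hG : garside (presented_monoid R))
    (hatD : presented_monoid R) (hhatD : minimal_fundamental hatD)
    (D : presented_monoid R) (hqc : quasi_central D) (hind : indecomposable D) :
  ldivides D hatD /\ rdivides D hatD.
Proof.
case: hG => atG canG lcmG _; case: hhatD => fundH _.
have DH := indecomposable_ldivides_fundamental atG canG lcmG
  (@presented_atoms_letters L R) fundH hqc hind.
by split=> //; exact: quasi_central_ldivides_rdivides.
Qed.
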